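(* Every Valdivia compact is a Kempisty space.
   Context: A topological space is Baire if every countable intersection of dense open subsets is dense. A mapping $g:X\to Z$ between topological spaces is quasi-continuous if for every $x_0\in X$, every neighborhood $U$ of $x_0$ and every neighborhood $V$ of $g(x_0)$ there is a nonempty open in $X$ set $G\subseteq U$ with $g(G)\subseteq V$. A function $f:X\times Y\to\mathbb R$ is quasi-continuous in the first variable if $x\mapsto f(x,y)$ is quasi-continuous for each $y\in Y$, and continuous in the second variable if $y\mapsto f(x,y)$ is continuous for each $x\in X$. A mapping $f:X\times Y\to Z$ has the Namioka property if there exists a dense in $X$ $G_\delta$-set $A\subseteq X$ such that $f$ is jointly continuous at each point of $A\times Y$. A topological space $Y$ is a Kempisty space if for every Baire space $X$ every function $f:X\times Y\to\mathbb R$ which is quasi-continuous in the first variable and continuous in the second variable has the Namioka property. For a set $T$, the $\Sigma$-subspace of $[0,1]^T$ is $\Sigma=\{x\in[0,1]^T: |\{t\in T:x(t)\ne0\}|\le\aleph_0\}$. A compact space $Y$ is a Valdivia compact if for some set $T$ there is a homeomorphic embedding $\varphi:Y\to[0,1]^T$ such that $\varphi(Y)\cap\Sigma$ is dense in $\varphi(Y)$. *)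

(* Defs.v *)
From mathcomp Require Import all_boot all_order all_algebra.
From mathcomp Require Import all_classical all_reals all_analysis borel_hierarchy.

Set Implicit Arguments.
Unset Strict Implicit.
Unset Printing Implicit Defensive.

Import Order.TTheory GRing.Theory Num.Theory.
Import numFieldNormedType.Exports.

Local Open Scope classical_set_scope.
Local Open Scope ring_scope.

Definition Baire_space (X : topologicalType) : Prop :=
  forall F : (set X)^nat,
    (forall n, open (F n) /\ dense (F n)) -> dense (\bigcap_n F n).

Definition quasi_continuous (X Z : topologicalType) (g : X -> Z) : Prop :=
  forall (x0 : X) (U : set X) (V : set Z), nbhs x0 U -> nbhs (g x0) V ->
    exists G : set X, [/\ open G, G !=set0, G `<=` U & g @` G `<=` V].

Definition Namioka_property (X Y Z : topologicalType) (f : X * Y -> Z) : Prop :=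
  exists A : set X, [/\ dense A, Gdelta A &
    forall (x : X) (y : Y), A x -> {for (x, y), continuous f}].

Definition Kempisty_space (R : realType) (Y : topologicalType) : Prop :=
  forall X : topologicalType, Baire_space X ->
  forall f : X * Y -> R,
    (forall y : Y, quasi_continuous (fun x => f (x, y))) ->
    (forall x : X, continuous (fun y => f (x, y))) ->
    Namioka_property f.

(* `[0, 1] is coerced to a type here, carrying the subspace topology. *)
Definition cube (R : realType) (T : Type) : topologicalType :=
  {ptws T -> `[0 : R, 1]%classic}.

Definition Sigma_subspace (R : realType) (T : Type) : set (cube R T) :=
  [set x : T -> `[0 : R, 1]%classic | countable [set t | set_val (x t) != 0]].

(* The last condition says that phi is open onto its image. *)
Definition homeomorphic_embedding (Y Z : topologicalType) (phi : Y -> Z) : Prop :=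
  [/\ injective phi, continuous phi &
    forall U : set Y, open U ->
      exists2 W : set Z, open W & phi @` U = range phi `&` W].

(* The Hausdorff property need not be assumed: it is inherited from the cube. *)
Definition Valdivia_compact (R : realType) (Y : topologicalType) : Prop :=
  compact [set: Y] /\
  exists (T : Type) (phi : Y -> cube R T),
    homeomorphic_embedding phi /\
    range phi `<=` closure (range phi `&` @Sigma_subspace R T).

(* Main.v *)
Require Import Defs.
From HB Require Import structures.
From mathcomp Require Import all_boot all_order all_algebra.
From mathcomp Require Import all_classical all_reals all_analysis borel_hierarchy.
From mathcomp Require Import lra.

(** Write [osc G] for the supremum of [|f (x, y) - f (x', y)|] over [x, x'] in
    [G] and [y] in [Y].  If for each [e > 0] the open sets [G] with
    [osc G <= e] have dense union [W e], then [A], the intersection of the sets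
    [W (1 / (n + 1))], is a dense G_delta set because [X] is Baire, and at
    [x] in [A] the functions [f (x', -)] converge uniformly to [f (x, -)] as
    [x'] tends to [x], which gives joint continuity on [A * Y]
    ([Namioka_property_of_small_oscillation]).

    Suppose that [W e] misses a nonempty open set [U], so that every nonempty
    open [V] included in [U] has [osc V > e].  A topological game on [U] then
    leads to a contradiction.  Let [D] be the dense set of points of [Y] with
    countable support.  Given finitely many coordinates and a tolerance,
    compactness provides a finite set of points of [D] that meets every class
    of points of [Y] close in these coordinates; quasi-continuity shrinks [V] to
    a set where [f (-, z)] is almost constant for these finitely many [z]; the
    large oscillation in [y] then forces [|f (x, y) - f (x, z)| > e / 6] for
    some [y, z] in [D] close in the given coordinates and for all [x] in some
    nonempty open [G] included in [V] ([separating_pair]).  So one can play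
    pairs [(y_n, z_n)], requiring at round [n] closeness up to [1 / (n + 1)] in
    the first [n] coordinates of the support of each earlier point.

    Since [X] is Baire, some play has a point [x] common to all its open sets
    ([Baire_play], the tree argument behind Oxtoby's theorem).  By compactness
    the pairs accumulate at some [(u, v)].  The points [u] and [v] agree on the
    union [S] of the supports of all points played, and both vanish outside [S]
    as limits of points supported in [S].  Thus [u = v], whereas continuity of
    [f (x, -)] gives [|f (x, u) - f (x, v)| >= e / 6]
    ([separating_sequence_absurd]). *)

Set Implicit Arguments.
Unset Strict Implicit.
Unset Printing Implicit Defensive.

Import Order.TTheory GRing.Theory Num.Theory.
Import numFieldNormedType.Exports.

Local Open Scope classical_set_scope.
Local Open Scope ring_scope.

(** * A topological game on Baire spaces *)

(** A set [V] missing all members of the family would contain some [F i] that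
    could be added to it, against maximality. *)
Lemma dense_maximal_disjoint (X : topologicalType) (I : Type)
    (F : I -> set X) (B E : set I) (W : set X) :
    (forall i, B i -> F i !=set0) ->
    (forall V, open V -> V !=set0 -> V `<=` W -> exists2 i, B i & F i `<=` V) ->
    maximal_disjoint_subcollection F E B ->
  forall V, open V -> V !=set0 -> V `<=` W ->
    exists2 i, E i & V `&` F i !=set0.
Proof.
move=> F0 BV [EB tE maxE] V oV V0 VW; apply: contrapT => noE.
have disj i : E i -> V `&` F i = set0.
  by move=> Ei; apply: contrapT => /eqP/set0P VF; apply: noE; exists i.
have [i Bi FiV] := BV V oV V0 VW.
have Fij j : E j -> ~ (F i `&` F j !=set0).
  move=> Ej [x [Fix Fjx]]; have : (V `&` F j) x by split => //; exact: FiV.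
  by rewrite disj.
apply: (maxE (E `|` [set i])).
- split; first by move=> j; left.
  move=> /(_ i (or_intror erefl)) Ei; apply: (Fij i Ei).
  by rewrite setIid; exact: F0.
- by move=> j [/EB//|->].
move=> j k [Ej|->] [Ek|->] //.
- exact: tE.
- by rewrite setIC => /(Fij _ Ej).
- by move=> /(Fij _ Ek).
Qed.

(** One direction of Oxtoby's theorem: in a Baire space the player who answers
    [V] by [(d, G)] has no winning strategy in the Choquet game, i.e., some
    play of that strategy has a point [x] in all its sets [G].  A single run
    of the strategy may well have empty intersection, so a whole tree of runs is
    considered: below each node a maximal disjoint family of answers is
    retained.  Each level of the tree is then disjoint with union dense in [U],
    and a point [x] in the unions of all levels lies on a single branch. *)
Lemma Baire_play (X : topologicalType) (D : Type) (U : set X)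
    (Q : seq D -> D -> set X) :
    Baire_space X -> open U -> U !=set0 ->
    (forall h V, open V -> V !=set0 -> V `<=` U ->
      exists d (G : set X), [/\ open G, G !=set0, G `<=` V & G `<=` Q h d]) ->
  exists (d : nat -> D) (x : X), forall n, Q (mkseq d n) (d n) x.
Proof.
move=> bX oU U0 step.
(* A node of the tree: the moves so far and the current open set. *)
pose S : Type := (seq D * set X)%type.
pose B (s : S) : set S := [set s' | exists d, [/\ s'.1 = rcons s.1 d,
  open s'.2, s'.2 !=set0, s'.2 `<=` s.2 & s'.2 `<=` Q s.1 d]].
pose E (s : S) : set S := sval (ex_maximal_disjoint_subcollection snd (B s)).
have EP s : maximal_disjoint_subcollection snd (E s) (B s).
  by rewrite /E; case: (ex_maximal_disjoint_subcollection _ _).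
pose L := fix L n : set S :=
  if n is m.+1 then \bigcup_(s in L m) E s else [set ([::], U)].
have EB s s' : E s s' -> B s s' by case: (EP s) => + _ _; apply.
have Lopen n s : L n s -> [/\ open s.2, s.2 !=set0 & s.2 `<=` U].
  elim: n s => [s ->|n IH s [s' /IH[_ _ sU'] /EB[d [_ o0 n0 ss' _]]]].
    by split => //; exact: subset_refl.
  by split => //; exact: subset_trans ss' sU'.
have Lsub s s' : E s s' -> s'.2 `<=` s.2 by move=> /EB[d []].
have Ltriv n : trivIset (L n) snd.
  elim: n => [i j -> -> //|n IH i j [s Ls Esi] [t Lt Etj] [x [ix jx]]].
  have st : s = t by apply: IH => //; exists x; split; [exact: Lsub ix|exact: Lsub jx].
  case: (EP s) => _ + _; apply => //; first by rewrite st.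
  by exists x.
have Edense s V : s.2 `<=` U -> open V -> V !=set0 -> V `<=` s.2 ->
    exists2 s', E s s' & V `&` s'.2 !=set0.
  move=> sU oV V0 Vs; apply: dense_maximal_disjoint (EP s) V oV V0 Vs.
    by move=> s' [d []].
  move=> W oW W0 Ws.
  have [d [G [oG G0 GW GQ]]] := step s.1 W oW W0 (subset_trans Ws sU).
  by exists (rcons s.1 d, G) => //; exists d; split => //; exact: subset_trans GW Ws.
have Ldense n V : open V -> V !=set0 -> V `<=` U ->
    exists2 s, L n s & V `&` s.2 !=set0.
  elim: n V => [V _ [x Vx] VU|n IH V oV V0 VU].
    by exists ([::], U) => //; exists x; split => //; exact: VU.
  have [s Ls Vs] := IH V oV V0 VU; have [os _ sU] := Lopen n s Ls.
  have [s' Es' [x [[Vx _] s'x]]] := Edense s (V `&` s.2) sU (openI oV os) Vs (@subIsetr _ _ _).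
  by exists s'; [exists s|exists x].
(* Adding the exterior of U turns density in U into density in X. *)
pose F n := \bigcup_(s in L n) s.2 `|` ~` closure U.
have Fod n : open (F n) /\ dense (F n).
  split.
    apply: openU; last exact: closed_openC (@closed_closure _ _).
    by apply: bigcup_open => s /Lopen[].
  move=> V [v Vv] oV.
  have [UV|UV] := pselect ((V `&` U) !=set0).
    have [s Ls [x [[Vx _] sx]]] := Ldense n (V `&` U) (openI oV oU) UV (@subIsetr _ _ _).
    by exists x; split => //; left; exists s.
  exists v; split => //; right => /(_ V (open_nbhs_nbhs (conj oV Vv))).
  by rewrite setIC.
have [x [Ux Fx]] := bX F Fod U U0 oU.
have Lx n : exists2 s, L n s & s.2 x.
  have [[s Ls sx]|] := Fx n I; first by exists s.
  by case; exact: subset_closure.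
(* By disjointness of level n, the parent of the node of level n.+1 containing
   x is the node of level n containing x: the branch through x is a play. *)
have ex_next n (s : S) : exists s', L n s -> s.2 x -> E s s' /\ s'.2 x.
  have [[Ls sx]|h] := pselect (L n s /\ s.2 x); last first.
    by exists s => Ls sx; case: h.
  have [s' [t Lt Ets'] s'x] := Lx n.+1; exists s' => _ _; split => //.
  by rewrite (_ : s = t)//; apply: (Ltriv n) => //; exists x; split => //; exact: Lsub s'x.
have [next nextP] : {next : nat -> S -> S | forall n s, L n s -> s.2 x ->
    E s (next n s) /\ (next n s).2 x}.
  by apply: cid; have /choice[g gP] := fun p : nat * S => ex_next p.1 p.2;
    exists (fun n s => g (n, s)) => n s; exact: (gP (n, s)).
pose play := fix play n := if n is m.+1 then next m (play m) else ([::], U).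
have playP n : L n (play n) /\ (play n).2 x.
  elim: n => [//|n [Ln nx]]; have [En nx'] := nextP n (play n) Ln nx.
  by split => //; exists (play n).
have /choice[d dP] n : exists d, (play n.+1).1 = rcons (play n).1 d /\ Q (play n).1 d x.
  have [Ln nx] := playP n; have [/EB[d [sd _ _ _ sQ]] nx'] := nextP n (play n) Ln nx.
  by exists d; split => //; exact: sQ.
have hist n : (play n).1 = mkseq d n.
  by elim: n => [//|n IH]; rewrite (dP n).1 IH /mkseq -addn1 iotaD map_cat cats1.
by exists d, x => n; rewrite -hist; exact: (dP n).2.
Qed.

(** * Separating pairs on large oscillation *)

Lemma quasi_continuous_small_oscillation (R : realType) (X : topologicalType)
    (I : eqType) (g : I -> X -> R) (s : seq I) (eta : R) (V : set X) :
    (forall i, quasi_continuous (g i)) -> 0 < eta -> open V -> V !=set0 ->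
  exists G : set X, [/\ open G, G !=set0, G `<=` V &
    forall i x x', i \in s -> G x -> G x' -> `|g i x - g i x'| < eta].
Proof.
move=> qg eta0 oV V0; elim: s => [|i s [G [oG [x0 Gx0] GV Gs]]].
  by exists V; split.
have nG : nbhs x0 G by apply: open_nbhs_nbhs.
have nB : nbhs (g i x0) (ball (g i x0) (eta / 2)).
  by apply: nbhsx_ballx; rewrite divr_gt0.
have [H [oH H0 HG HB]] := qg i x0 _ _ nG nB.
exists H; split => //; first exact: subset_trans HG GV.
move=> j x x'; rewrite inE => /orP[/eqP->{j}|js] Hx Hx'; last first.
  by apply: Gs => //; exact: HG.
have Bx : ball (g i x0) (eta / 2) (g i x) by apply: HB; exists x.
have Bx' : ball (g i x0) (eta / 2) (g i x') by apply: HB; exists x'.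
exact: ball_splitr Bx Bx'.
Qed.

(** The sets of points close to [z] in the finitely many functions [g i], for
    [z] in [D], form an open cover. *)
Lemma compact_dense_net (R : realType) (Y : topologicalType) (D : set Y)
    (I : eqType) (g : I -> Y -> R) (s : seq I) (eta : R) :
    compact [set: Y] -> dense D -> (forall i, i \in s -> continuous (g i)) ->
    0 < eta ->
  exists zs : seq Y, (forall z, z \in zs -> D z) /\
    forall y, exists2 z, z \in zs & forall i, i \in s -> `|g i y - g i z| < eta.
Proof.
move=> cY dD cg eta0.
pose N z := [set y | forall i, i \in s -> `|g i y - g i z| < eta].
have oN z : open (N z).
  rewrite {}/N; elim: s cg => [|i s IH] cg.
    by rewrite (_ : [set _ | _] = setT) ?predeqE//; exact: openT.
  rewrite (_ : [set _ | _] = (g i @^-1` ball (g i z) eta) `&`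
      [set y | forall j, j \in s -> `|g j y - g j z| < eta]).
    apply: openI; last by apply: IH => j js; apply: cg; rewrite inE js orbT.
    apply: open_comp; last exact: ball_open.
    by move=> y _; apply: cg; rewrite mem_head.
  rewrite predeqE => y; split => [h|[h1 h2] j].
    split; last by move=> j js; apply: h; rewrite inE js orbT.
    by rewrite /= /ball /= distrC; apply: h; rewrite mem_head.
  rewrite inE => /orP[/eqP->|/h2//].
  by move: h1; rewrite /= /ball /= distrC.
(* If Y is empty, the empty net works; otherwise Y can be given a base point,
   as the finite-subcover form of compactness requires. *)
have [y0|noY] := pselect ([set: Y] !=set0); last first.
  by exists [::]; split => // y; case: noY; exists y.
have {y0} y0 : Y := sval (cid y0).
pose Yp : ptopologicalType := HB.pack_for ptopologicalType Y (isPointed.Build Y y0).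
have : @cover_compact Yp setT by rewrite -compact_cover.
move=> /(_ Y D N (fun i _ => oN i)) [].
  move=> y _; have [|z [Nz Dz]] := dD (N y) _ (oN y).
    by exists y => i _; rewrite subrr normr0.
  by exists z => // i /Nz; rewrite distrC.
move=> D' D'D cov; exists (finmap.enum_fset D'); split.
  by move=> z /D'D; rewrite inE.
by move=> y; have [z zD' Nz] := cov y Logic.I; exists z.
Qed.

(** The move of the game.  Choose [x1, x2] and [y] in [D] with
    [|f (x1, y) - f (x2, y)| > eps] in a set [W] where [f (-, z)] varies by less
    than [eps / 12] for every [z] of a finite net.  Let [z] be a point of the net
    close to [y].  As [f (x1, z)] and [f (x2, z)] nearly agree, one of [x1, x2] is
    a point [x] with [|f (x, y) - f (x, z)| > eps / 3]; passing to a set where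
    [f (-, y)] stays within [eps / 12] of [f (x, y)] preserves [eps / 6]. *)
Lemma separating_pair (R : realType) (X Y : topologicalType) (f : X * Y -> R)
    (D : set Y) (U V : set X) (eps : R) (I : eqType) (g : I -> Y -> R)
    (s : seq I) (eta : R) :
    compact [set: Y] -> dense D ->
    (forall y, quasi_continuous (fun x => f (x, y))) ->
    (forall x, continuous (fun y => f (x, y))) ->
    0 < eps ->
    (forall W, open W -> W !=set0 -> W `<=` U ->
      exists x x' y, [/\ W x, W x' & eps < `|f (x, y) - f (x', y)|]) ->
    (forall i, i \in s -> continuous (g i)) -> 0 < eta ->
    open V -> V !=set0 -> V `<=` U ->
  exists (y z : Y) (G : set X), [/\ D y, D z,
    forall i, i \in s -> `|g i y - g i z| < eta,
    [/\ open G, G !=set0 & G `<=` V] &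
    forall x, G x -> eps / 6 < `|f (x, y) - f (x, z)|].
Proof.
move=> cY dD qf cf eps0 osc cg eta0 oV V0 VU.
have [zs [zsD net]] := compact_dense_net cY dD cg eta0.
have e12 : 0 < eps / 12 by rewrite divr_gt0.
have [W [oW W0 WV oscW]] := quasi_continuous_small_oscillation zs qf e12 oV V0.
have [x1 [x2 [y1 [Wx1 Wx2 big1]]]] := osc W oW W0 (subset_trans WV VU).
have [y Dy big] : exists2 y, D y & eps < `|f (x1, y) - f (x2, y)|.
  have oP : open ((fun y => `|f (x1, y) - f (x2, y)|) @^-1` [set r | eps < r]).
    apply: open_comp; last exact: open_gt.
    by move=> w _; apply: cvg_norm; apply: cvgB; exact: cf.
  by have [|y [? ?]] := dD _ _ oP; [exists y1|exists y].
have [z zzs yz] := net y.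
have [x Wx xbig] : exists2 x, W x & eps / 3 < `|f (x, y) - f (x, z)|.
  have := oscW z x1 x2 zzs Wx1 Wx2 => small.
  apply: contrapT => no.
  have b1 : `|f (x1, y) - f (x1, z)| <= eps / 3.
    by rewrite leNgt; apply/negP => h; apply: no; exists x1.
  have b2 : `|f (x2, y) - f (x2, z)| <= eps / 3.
    by rewrite leNgt; apply/negP => h; apply: no; exists x2.
  move: small b1 b2 big; rewrite ltr_norml !ler_norml ltr_normr.
  by move=> /andP[? ?] /andP[? ?] /andP[? ?] /orP[]; lra.
have nB : nbhs (f (x, y)) (ball (f (x, y)) (eps / 12)) by exact: nbhsx_ballx.
have nW : nbhs x W by exact: open_nbhs_nbhs.
have [G [oG G0 GW GB]] := qf y x W _ nW nB.
exists y, z, G; split => //; first exact: zsD.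
  by split => //; exact: subset_trans GW WV.
move=> t Gt; have small := oscW z x t zzs Wx (GW _ Gt).
have : ball (f (x, y)) (eps / 12) (f (t, y)) by apply: GB; exists t.
rewrite /ball /=; move: small xbig; rewrite !ltr_norml !ltr_normr.
by move=> /andP[? ?] /orP[?|?] /andP[? ?]; apply/orP; [left|right]; lra.
Qed.

(** * Reduction to small oscillation *)

Definition small_oscillation (R : realType) (X Y : topologicalType)
    (f : X * Y -> R) (e : R) : set (set X) :=
  [set G | open G /\ forall x x' y, G x -> G x' -> `|f (x, y) - f (x', y)| <= e].

Lemma Namioka_property_of_small_oscillation (R : realType)
    (X Y : topologicalType) (f : X * Y -> R) :
    Baire_space X -> (forall x, continuous (fun y => f (x, y))) ->
    (forall e, 0 < e -> dense (\bigcup_(G in small_oscillation f e) G)) ->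
  Namioka_property f.
Proof.
move=> bX cf dW; pose W (e : R) := \bigcup_(G in small_oscillation f e) G.
have oW e : open (W e) by apply: bigcup_open => G [].
exists (\bigcap_n W n.+1%:R^-1); split.
- by apply: bX => n; split; [exact: oW|apply: dW; rewrite invr_gt0].
- by exists (fun n => W n.+1%:R^-1).
move=> x y Ax; apply/cvgrPdist_lt => e e0.
have [n _ /(_ n (leqnn n)) ne] := near_infty_natSinv_lt (PosNum (divr_gt0 e0 (ltr0n R 2))).
have [G [oG Gsmall] Gx] := Ax n Logic.I.
have nG : nbhs x G by exact: open_nbhs_nbhs.
have /cvgrPdist_lt/(_ _ (divr_gt0 e0 (ltr0n R 2))) cy := cf x y.
exists (G, [set y' | `|f (x, y) - f (x, y')| < e / 2]) => //=.
move=> [x' y'] /= [Gx' h].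
rewrite (le_lt_trans (ler_distD (f (x, y')) _ _))// [ltRHS]splitr ltrD//.
by rewrite (le_lt_trans (Gsmall _ _ _ Gx Gx')).
Qed.

(** * Sequences of separating pairs *)

(** For each [p] in [D] the functions [c p k] stand for the coordinates in the
    countable support of [p].  The last hypothesis on [c] abstracts the fact that
    a point in the closure of [C] is determined by its coordinates in the
    supports of the points of [C].  The accumulation point [(u, v)] of the
    sequence then lies on the diagonal, where [h] would have a jump. *)
Lemma separating_sequence_absurd (R : realType) (Y : topologicalType)
    (D : set Y) (c : Y -> nat -> Y -> R) (h : Y -> R) (d : nat -> Y * Y) (e : R) :
    compact [set: Y] ->
    (forall p k, D p -> continuous (c p k)) ->
    (forall (C : set Y) u v, C `<=` D -> closure C u -> closure C v ->
      (forall p k, C p -> c p k u = c p k v) -> u = v) ->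
    continuous h -> 0 < e ->
    (forall n, D (d n).1 /\ D (d n).2) ->
    (forall n i k, (i < n)%N -> (k < n)%N ->
      forall p, p = (d i).1 \/ p = (d i).2 ->
      `|c p k (d n).1 - c p k (d n).2| < n.+1%:R^-1) ->
    (forall n, e <= `|h (d n).1 - h (d n).2|) ->
  False.
Proof.
move=> cY cc csep ch e0 dD dclose dh.
have cYY : compact [set: Y * Y] by rewrite -setXTT; exact: compact_setX.
have [[u v] [_ uv]] := cYY (d @ \oo) _ filterT.
have limit K : closed K -> (\forall n \near \oo, K (d n)) -> K (u, v).
  by move=> cK nK; apply: cK => B; exact: uv.
have cdist (g : Y -> R) : continuous g ->
    continuous (fun w : Y * Y => `|g w.1 - g w.2| : R).
  move=> cg w; apply: cvg_norm; apply: cvgB.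
    by apply: (@cvg_comp _ _ _ fst g); [exact: cvg_fst|exact: cg].
  by apply: (@cvg_comp _ _ _ snd g); [exact: cvg_snd|exact: cg].
pose P := range (fst \o d) `|` range (snd \o d).
have PD : P `<=` D by move=> p [[n _ <-]|[n _ <-]]; case: (dD n).
have Pu : closure P u.
  apply: (limit (fst @^-1` closure P)).
    by apply: closed_comp (@closed_closure _ P) => w _; exact: cvg_fst.
  by apply: nearW => n; apply: subset_closure; left; exists n.
have Pv : closure P v.
  apply: (limit (snd @^-1` closure P)).
    by apply: closed_comp (@closed_closure _ P) => w _; exact: cvg_snd.
  by apply: nearW => n; apply: subset_closure; right; exists n.
have uv_eq : u = v.
  apply: (csep P) => // p k Pp; apply/eqP; rewrite -subr_eq0 -normr_le0.
  apply/ler_addgt0Pl => eta eta0; rewrite addr0.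
  apply: (limit [set w | `|c p k w.1 - c p k w.2| <= eta]).
    have /continuous_closedP := cdist _ (cc p k (PD _ Pp)).
    by move=> /(_ _ (@closed_le _ eta)).
  have [i pi] : exists i, p = (d i).1 \/ p = (d i).2.
    by case: Pp => [[i _ <-]|[i _ <-]]; exists i; [left|right].
  near=> n; apply: ltW; apply: (@lt_trans _ _ n.+1%:R^-1).
    apply: (dclose n i k) => //; near: n; exact: nbhs_infty_gt.
  by near: n; exact: (near_infty_natSinv_lt (PosNum eta0)).
have : e <= `|h u - h v|.
  apply: (limit [set w | e <= `|h w.1 - h w.2|]).
    have /continuous_closedP := cdist _ ch.
    by move=> /(_ _ (@closed_ge _ e)).
  exact: nearW.
by rewrite uv_eq subrr normr0 leNgt e0.
Unshelve. all: by end_near. Qed.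

Lemma Kempisty_of_countable_separation (R : realType) (Y : topologicalType)
    (D : set Y) (c : Y -> nat -> Y -> R) :
    compact [set: Y] -> dense D ->
    (forall p k, D p -> continuous (c p k)) ->
    (forall (C : set Y) u v, C `<=` D -> closure C u -> closure C v ->
      (forall p k, C p -> c p k u = c p k v) -> u = v) ->
  Kempisty_space R Y.
Proof.
move=> cY dD cc csep X bX f qf cf.
apply: Namioka_property_of_small_oscillation => // e e0 U U0 oU.
apply: contrapT => UW.
have osc V : open V -> V !=set0 -> V `<=` U ->
    exists x x' y, [/\ V x, V x' & e < `|f (x, y) - f (x', y)|].
  move=> oV [x0 Vx0] VU; apply: contrapT => no; apply: UW.
  exists x0; split; first exact: VU.
  exists V => //; split => // x x' y Vx Vx'; rewrite leNgt; apply/negP => h.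
  by apply: no; exists x, x', y.
(* C h is the set of points played so far.  As the strategy must answer every
   history, even one that leaves D, Q constrains only the points in D. *)
pose C h := map fst h ++ map snd h : seq Y.
pose Q (h : seq (Y * Y)) (d : Y * Y) : set X := [set x | [/\ D d.1, D d.2,
  forall p k, p \in C h -> D p -> (k < size h)%N ->
    `|c p k d.1 - c p k d.2| < (size h).+1%:R^-1 &
  e / 6 < `|f (x, d.1) - f (x, d.2)|]].
have [|d [x dx]] := @Baire_play X _ U Q bX oU U0.
  move=> h V oV V0 VU.
  pose s := [seq i <- [seq (p, k) | p <- C h, k <- iota 0 (size h)] | i.1 \in D].
  have [||y [z [G [Dy Dz yz [oG G0 GV] big]]]] := @separating_pair R X Y f D U V e
    _ (fun i => c i.1 i.2) s (size h).+1%:R^-1 cY dD qf cf e0 osc _ _ oV V0 VU.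
  - by move=> i; rewrite mem_filter => /andP[/set_mem Di _]; exact: cc.
  - by rewrite invr_gt0.
  exists (y, z), G; split => // t Gt; split => //=; last exact: big.
  move=> p k pC Dp kh; apply: (yz (p, k)); rewrite mem_filter /= mem_set//=.
  by apply/allpairsP; exists (p, k); rewrite mem_iota.
have mem_C i n : (i < n)%N ->
    (d i).1 \in C (mkseq d n) /\ (d i).2 \in C (mkseq d n).
  by move=> ni; rewrite !mem_cat -!map_comp; split; apply/orP; [left|right];
    apply: map_f; rewrite mem_iota.
apply: (@separating_sequence_absurd R Y D c (fun y => f (x, y)) d (e / 6)) => //.
- by rewrite divr_gt0.
- by move=> n; case: (dx n).
- move=> n i k ni kn p pi; have [_ _ close _] := dx n.
  have [Di1 Di2 _ _] := dx i; have [i1 i2] := mem_C i n ni.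
  by move: close; rewrite size_mkseq; apply => //; case: pi => ->.
- by move=> n; have [_ _ _ /ltW] := dx n.
Qed.

(** * Coordinates of a Valdivia compact *)

(** [D] is the trace on [Y] of the Sigma-subspace and [c p] enumerates the
    coordinates in the support of [p], with the zero function as a filler when
    the enumeration has gaps. *)
Lemma Valdivia_separation (R : realType) (Y : topologicalType) :
  Valdivia_compact R Y -> exists (D : set Y) (c : Y -> nat -> Y -> R),
    [/\ dense D, forall p k, D p -> continuous (c p k) &
    forall (C : set Y) u v, C `<=` D -> closure C u -> closure C v ->
      (forall p k, C p -> c p k u = c p k v) -> u = v].
Proof.
move=> [cY [T [phi [[injphi cphi ophi] dSigma]]]].
pose coord (t : T) (u : Y) : R := set_val ((phi u : T -> `[0 : R, 1]%classic) t).
have ccoord t : continuous (coord t).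
  have cval := @initial_continuous (`[0 : R, 1]%classic : set R) R set_val.
  have cproj := @proj_continuous {classic T} (fun=> `[0 : R, 1]%classic) t.
  move=> u; apply: (@continuous_comp _ _ _ (fun u => phi u t) set_val).
    by apply: (@continuous_comp _ _ _ phi (fun g => g t)); [exact: cphi|exact: cproj].
  exact: cval.
pose D : set Y := phi @^-1` @Sigma_subspace R T.
pose supp (p : Y) : set T := [set t | coord t p != 0].
have enum p : exists e : nat -> option T,
    D p -> forall t, supp p t -> exists k, e k = Some t.
  have [Dp|nDp] := pselect (D p); last by exists (fun=> None).
  have /countable_injP[i iinj] : countable (supp p) by [].
  have ek k : exists o, forall t, supp p t -> i t = k -> o = Some t.
    have [[t [st <-]]|no] := pselect (exists t, supp p t /\ i t = k).
      by exists (Some t) => t' st' /iinj ->//; rewrite inE.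
    by exists None => t st it; case: no; exists t.
  have /choice[e eP] := ek.
  by exists e => _ t st; exists (i t); exact: eP.
have /choice[e eP] := enum.
exists D, (fun p k u => if e p k is Some t then coord t u else 0); split.
- move=> O [y Oy] oO; have [W oW OW] := ophi O oO.
  have Wy : (range phi `&` W) (phi y) by rewrite -OW; exists y.
  have [_ [[[y' _ <-] Dy'] Wy']] :=
    dSigma (phi y) Wy.1 W (open_nbhs_nbhs (conj oW Wy.2)).
  have : (phi @` O) (phi y') by rewrite OW; split => //; exists y'.
  by move=> [y'' Oy'' /injphi yy]; exists y'; split => //; rewrite -yy.
- move=> p k _; case: (e p k) => [t|]; first exact: ccoord.
  exact: cst_continuous.
move=> C u v CD Cu Cv Ceq; apply: injphi; apply/funext => t; apply/val_inj.
have [[p Cp pt]|no] := pselect (exists2 p, C p & supp p t).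
  have [k ek] := eP p (CD _ Cp) t pt.
  by have := Ceq p k Cp; rewrite ek.
(* Outside the supports of the points of C, coordinates vanish on C, hence on
   its closure. *)
have zero w : closure C w -> coord t w = 0.
  have /continuous_closedP/(_ _ (@closed_eq R 0)) cl0 := ccoord t.
  move=> Cw; apply: cl0; apply: closure_subset Cw => p Cp /=.
  by apply/eqP; apply: contrapT => /negP pt; apply: no; exists p.
by change (coord t u = coord t v); rewrite !zero.
Qed.

Theorem corollary3p5 (R : realType) (Y : topologicalType)
    (hY : Valdivia_compact R Y) : Kempisty_space R Y.
Proof.
have [D [c [dD cc csep]]] := Valdivia_separation hY.
exact: Kempisty_of_countable_separation hY.1 dD cc csep.
Qed.
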